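(* Let $T$ be a triangulation of a closed surface $M$ with vertices $V=\{v_1,\dots,v_N\}$, let $d$ be a PL metric associated to $T$, and consider the normalized combinatorial Yamabe flow $$\frac{du_i}{dt}=-u_i(K_i-K_{av}),\qquad u_i(0)=1,\qquad i=1,\dots,N.$$ (a) For any such triangulated surface (and any $d$), the normalized combinatorial Yamabe flow does not develop an essential singularity at any finite time $L<\infty$. (b) If the triangulation $T$ is admissible, then the normalized combinatorial Yamabe flow does not develop an essential singularity at time $L=\infty$.
   Context: Let $E$ be the set of edges of $T$. A PL metric associated to $T$ is a function $d:E\to\mathbb{R}_{>0}$ such that for every triangle of $T$ the three values of $d$ on its edges satisfy the strict triangle inequalities; each triangle is identified with the Euclidean triangle with these edge lengths. Given $u:V\to\mathbb{R}_{>0}$, $u_i=u(v_i)$, define $(u*d)(v_iv_j)=u_iu_jd(v_iv_j)$; $u$ is a conformal factor for $d$ if $u*d$ is again a PL metric. The curvature of a PL metric at $v_i$ is $2\pi$ minus the sum of the inner angles at $v_i$ of all triangles of $T$ having $v_i$ as a vertex. In the flow, $u(t)$ is a conformal factor for each $t$, $K_i=K_i(t)$ is the curvature at $v_i$ of $u(t)*d$, and $K_{av}=2\pi\chi(M)/N$. A triangulation $T$ is admissible if there exists a PL metric associated to $T$ whose curvature is the same at all vertices. A solution $u(t)$ of the normalized flow on $[0,L)$, $0<L\le\infty$, develops an essential singularity at time $L$ if there are an index $i$ and a sequence of times $t_n\in[0,L)$ with $t_n\to L$ such that $\lim_{n\to\infty}u_i(t_n)=0$. *)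

(* Defs.v *)
From mathcomp Require Import all_boot all_order all_algebra.
From mathcomp Require Import all_classical all_reals all_analysis.

Set Implicit Arguments.
Unset Strict Implicit.
Unset Printing Implicit Defensive.

Import Order.TTheory GRing.Theory Num.Theory.
Import numFieldNormedType.Exports.

Local Open Scope classical_set_scope.
Local Open Scope ring_scope.

(* A triangulation is a finite simplicial complex with vertex set V.  Since a
   closed surface is a pure 2-dimensional complex without isolated vertices,
   the complex is given by the set T of its triangles, each of them being the
   set of its three vertices. *)

Section Triangulation.
Variables (V : finType) (T : {set {set V}}).

Definition edges : {set {set V}} :=
  [set e : {set V} | (#|e| == 2)%N && [exists f in T, e \subset f]]%SET.

Definition link_edges (v : V) : {set {set V}} :=
  [set e : {set V} | (v \notin e) && ((v |: e)%SET \in T)]%SET.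

Definition link_is_circle (v : V) : Prop :=
  exists s : seq V, [/\ uniq s, (2 < size s)%N &
    link_edges v = [set [set x; next s x] | x in s]%SET].

(* The realization of T is a (connected) closed surface exactly when the link
   of every vertex is a simple closed polygon and the 1-skeleton is connected.
   The link condition also forces every edge to lie in exactly two triangles. *)
Definition closed_surface_triangulation : Prop :=
  [/\ (0 < #|V|)%N,
      forall f, f \in T -> #|f| = 3%N,
      forall v, link_is_circle v &
      forall x y, connect [rel a b | [set a; b]%SET \in edges] x y].

Definition euler_characteristic : int :=
  #|V|%:Z - #|edges|%:Z + #|T|%:Z.

End Triangulation.

Section PLMetric.
Variables (R : realType) (V : finType) (T : {set {set V}}).

(* Only the values of d on [edges T] are ever used. *)
Definition pl_metric (d : {set V} -> R) : Prop :=
  (forall e, e \in edges T -> 0 < d e) /\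
  (forall i j k, [set i; j; k]%SET \in T ->
     d [set i; j]%SET < d [set i; k]%SET + d [set k; j]%SET).

(* For an edge e = {i, j} this is u i * u j * d e. *)
Definition conformal_change (u : V -> R) (d : {set V} -> R) (e : {set V}) : R :=
  (\prod_(i in e) u i) * d e.

Definition conformal_factor (d : {set V} -> R) (u : V -> R) : Prop :=
  (forall i, 0 < u i) /\ pl_metric (conformal_change u d).

(* Law of cosines for the triangle f = {i, j, k} at its vertex i: the side
   opposite to a vertex j of f is the edge f :\ j, so the two sides adjacent
   to i are the f :\ j for j in f :\ i, and the formula reads
   acos ((d_ik ^+ 2 + d_ij ^+ 2 - d_jk ^+ 2) / (2 * (d_ik * d_ij))). *)
Definition inner_angle (d : {set V} -> R) (f : {set V}) (i : V) : R :=
  acos ((\sum_(j in (f :\ i)%SET) d (f :\ j)%SET ^+ 2 - d (f :\ i)%SET ^+ 2)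
        / (2 * \prod_(j in (f :\ i)%SET) d (f :\ j)%SET)).

Definition curvature (d : {set V} -> R) (i : V) : R :=
  2 * pi - \sum_(f in T | i \in f) inner_angle d f i.

Definition average_curvature : R :=
  2 * pi * (euler_characteristic T)%:~R / #|V|%:R.

Definition admissible : Prop :=
  exists2 d : {set V} -> R, pl_metric d &
    forall i j, curvature d i = curvature d j.

Definition flow_interval (L : \bar R) : set R :=
  [set t | 0 <= t /\ (t%:E < L)%E]%classic.

(* u solves the normalized combinatorial Yamabe flow on [0, L).  The time
   derivative is the limit of difference quotients within [0, L), hence the
   ordinary derivative for t > 0 and the right derivative at t = 0. *)
Definition normalized_yamabe_flow (d : {set V} -> R) (L : \bar R)
    (u : R -> V -> R) : Prop :=
  [/\ (0 < L)%E,
      forall i, u 0 i = 1,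
      forall t, flow_interval L t -> conformal_factor d (u t) &
      forall t, flow_interval L t -> forall i,
        (u s i - u t i) / (s - t) @[s --> within (flow_interval L) t^'] -->
        - u t i * (curvature (conformal_change (u t) d) i
                   - average_curvature)].

Definition essential_singularity (L : \bar R) (u : R -> V -> R) : Prop :=
  exists (i : V) (t : nat -> R),
    [/\ forall n, flow_interval L (t n),
        (t n)%:E @[n --> \oo] --> L &
        u (t n) i @[n --> \oo] --> (0 : R)].

End PLMetric.

(* Main.v *)
Require Import Defs.
From mathcomp Require Import all_boot all_order all_algebra.
From mathcomp Require Import all_classical all_reals all_analysis.
From mathcomp Require Import ring lra.

(** Put y_i = - ln u_i, so that y_i' = K_i - K_av.  An essential singularity at
    time L means that some y_i is unbounded above on [0, L), so it suffices to
    bound the y_i from above.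

    (a) Angles are nonnegative, hence K_i <= 2 pi and y_i grows at most linearly
    ([neg_log_linear_bound]).

    (b) Let d' be a PL metric of constant curvature, which by Gauss-Bonnet
    ([gauss_bonnet]) equals K_av.  It need not be conformal to d.  Let I be a
    proper nonempty set of vertices such that every y_i with i in I exceeds
    every y_k with k outside I by a large constant M.  Up to scaling, in a face
    of u * d the side opposite to a vertex i has length exp (y_i) times its
    length in d.  So a face cannot have just one vertex in I (triangle
    inequality), and in a face with exactly two vertices in I the angle at the
    third vertex is tiny, in particular smaller than in d'.  Since the angles of
    a face add up to pi, for each face that meets both I and its complement the
    sum of the angles at vertices of I is larger for u * d than for d'; for the
    other faces the two sums agree.  Hence the sum of K_i - K_av over I is
    negative ([separated_curvature_lt]), that is, the sum S_I of the y_i over I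
    is decreasing.

    This controls S_I at times when I is separated from its complement, and the
    sets I that are separated vary with time.  They are handled simultaneously
    by the region S_I < a (#|I|) for all proper nonempty I, where
    a (k) = M k (N - k) / 2.  Suppose that the solution, which starts at y = 0
    inside the region, first reaches its boundary at a time when S_I = a (#|I|).
    Comparing S_I with the sums over I with one vertex removed or added, and
    using that a has second difference - M (and that the sum of all y_i is
    constantly 0), one finds that I is then separated from its complement by M
    ([touching_separated]).  So S_I is decreasing at that time, whereas
    it was below a (#|I|) just before: a contradiction.  Hence the region is
    never left ([barrier_principle], [neg_log_bound]), and the singletons I
    yield a bound on each y_i. *)

Set Implicit Arguments.
Unset Strict Implicit.
Unset Printing Implicit Defensive.

Import Order.TTheory GRing.Theory Num.Theory.
Import numFieldNormedType.Exports.

Local Open Scope classical_set_scope.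
Local Open Scope ring_scope.

(** * Derivatives within a set and a barrier principle *)

Section DerivativeWithin.
Variable R : realType.
Implicit Types (D : set R) (g : R -> R) (t l : R).

(** For D = [0, L) this is the ordinary derivative at t > 0 and the right
    derivative at t = 0. *)
Definition derivative_within D g t l : Prop :=
  (g s - g t) / (s - t) @[s --> within D t^'] --> l.

Lemma derivative_within_cst D c t : derivative_within D (fun=> c) t 0.
Proof.
rewrite /derivative_within; under eq_fun do rewrite subrr mul0r.
exact: cvg_cst.
Qed.

Lemma derivative_within_id D t : derivative_within D id t 1.
Proof.
apply/cvgrPdist_lt => e e0; rewrite near_withinE.
near=> s => _; rewrite divff ?subrr ?normr0// subr_eq0.
by near: s; exact: nbhs_dnbhs_neq.
Unshelve. all: by end_near.
Qed.

Lemma derivative_withinD D g1 g2 t l1 l2 :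
  derivative_within D g1 t l1 -> derivative_within D g2 t l2 ->
  derivative_within D (fun s => g1 s + g2 s) t (l1 + l2).
Proof.
move=> h1 h2; rewrite /derivative_within.
under eq_fun do rewrite opprD addrACA mulrDl.
exact: cvgD.
Qed.

Lemma derivative_withinZ D g t l c :
  derivative_within D g t l -> derivative_within D (fun s => c * g s) t (c * l).
Proof.
move=> h; rewrite /derivative_within.
under eq_fun do rewrite -mulrBr -mulrA.
by apply: cvgM; [exact: cvg_cst|].
Qed.

Lemma derivative_within_sum (I : finType) (P : pred I) D (g : I -> R -> R) t
    (l : I -> R) :
  (forall i, derivative_within D (g i) t (l i)) ->
  derivative_within D (fun s => \sum_(i | P i) g i s) t (\sum_(i | P i) l i).
Proof.
move=> h; rewrite /derivative_within; under eq_fun do rewrite -sumrB mulr_suml.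
by apply: cvg_big => [|i _]; [exact: add_continuous | exact: h].
Qed.

Lemma derivative_within_cvg D g t l :
  derivative_within D g t l -> g s @[s --> within D t^'] --> g t.
Proof.
move=> h.
have h1 : s - t @[s --> within D t^'] --> (0 : R).
  rewrite -(subrr t); apply: cvgB; last exact: cvg_cst.
  by move=> U tU; apply: (filterS _ (nbhs_dnbhs tU)) => s Us _.
have := cvgM h h1; rewrite mulr0 => h2.
have h3 : (g s - g t) / (s - t) * (s - t) + g t @[s --> within D t^']
    --> 0 + g t by apply: cvgD; [exact: h2 | exact: cvg_cst].
rewrite add0r in h3; apply: cvg_trans; last exact: h3.
apply: near_eq_cvg; rewrite near_withinE.
near=> s => _ /=; rewrite /= divfK ?subrK// subr_eq0.
by near: s; exact: nbhs_dnbhs_neq.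
Unshelve. all: by end_near.
Qed.

(** Caratheodory's factorization of ln near g t turns the difference quotient
    of ln \o g into a product of two converging factors, with no case split on
    whether g s = g t. *)
Lemma derivative_within_ln D g t l :
  0 < g t -> derivative_within D g t l ->
  derivative_within D (fun s => ln (g s)) t (l / g t).
Proof.
move=> gt0 h.
have /is_derive1_caratheodory [k [kE kC kx]] := is_derive1_ln gt0.
rewrite /derivative_within; under eq_fun do rewrite kE -mulrA.
rewrite mulrC -kx; apply: cvgM => //.
exact: (@cvg_comp _ _ _ _ k _ _ _ (derivative_within_cvg h)).
Qed.

Lemma near_within_ball D t (P : R -> Prop) :
  (\forall s \near within D t^', P s) ->
  exists2 e : R, 0 < e & forall s, D s -> s != t -> `|s - t| < e -> P s.
Proof.
rewrite near_withinE => -[e e0 h]; exists e => // s Ds st ste.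
by apply: h => //=; rewrite distrC.
Qed.

(** A finite family of functions that starts negative stays negative, provided
    no member can reach 0 while the others are nonpositive unless its derivative
    is negative there.  At the infimum t of the times when some g j is
    nonnegative, all g j are nonpositive and one vanishes by continuity; being
    negative just before t, it cannot have a negative derivative at t.  All the
    estimates on solutions below, including the conservation law, come from this
    lemma. *)
Lemma barrier_principle (I : finType) (P : pred I) (L : \bar R)
    (g dg : I -> R -> R) :
  (forall t, flow_interval L t -> forall i, P i ->
     derivative_within (flow_interval L) (g i) t (dg i t)) ->
  (forall i, P i -> g i 0 < 0) ->
  (forall t, flow_interval L t -> (forall j, P j -> g j t <= 0) ->
     forall i, P i -> g i t = 0 -> dg i t < 0) ->
  forall t, flow_interval L t -> forall i, P i -> g i t < 0.
Proof.
move=> hd h0 hneg t1 Dt1 i1 Pi1; rewrite ltNge; apply/negP => gi1.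
pose A := [set t : R | 0 <= t <= t1 /\ exists2 i, P i & 0 <= g i t].
have At1 : A t1 by split; [rewrite lexx andbT; exact: Dt1.1 | exists i1].
have lbA : lbound A 0 by move=> x [/andP[]].
have hasA : has_inf A by split; [exists t1 | exists 0].
set t := inf A.
have t_ge0 : 0 <= t by apply: lb_le_inf => //; exists t1.
have le_tt1 : t <= t1 by apply: ge_inf => //; exists 0.
have Dlt s : 0 <= s -> s <= t1 -> flow_interval L s.
  by move=> s0 st; split=> //; apply: le_lt_trans Dt1.2; rewrite lee_fin.
have Dt := Dlt _ t_ge0 le_tt1.
have before s : 0 <= s -> s < t -> forall i, P i -> g i s < 0.
  move=> s0 st i Pi; rewrite ltNge; apply/negP => gis.
  have : t <= s.
    apply: ge_inf; [by exists 0 | split; last by exists i].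
    by rewrite s0 (ltW (lt_le_trans st _)).
  by rewrite leNgt st.
(* a point of [0, t) that is e-close to t, even when t is smaller than e *)
have left (e : R) : 0 < e -> 0 < t -> exists2 s, 0 <= s < t & `|s - t| < e.
  move=> e0 tgt0; exists (Num.max 0 (t - e / 2)).
    by rewrite le_max lexx gt_max tgt0/=; lra.
  have [h|h] := leP 0 (t - e / 2).
    by rewrite ler0_norm; lra.
  by rewrite ler0_norm; lra.
have le0 j : P j -> g j t <= 0.
  move=> Pj; have [t0|t0] := eqVneq t 0; first by rewrite t0 ltW ?h0.
  have tgt0 : 0 < t by rewrite lt_neqAle eq_sym t0.
  rewrite leNgt; apply/negP => gj.
  have /cvgrPdist_lt/(_ _ gj)/near_within_ball[e e0 he] :=
    derivative_within_cvg (hd _ Dt _ Pj).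
  have [s /andP[s0 st] se] := left e e0 tgt0.
  have := before _ s0 st _ Pj.
  have := he s (Dlt _ s0 (ltW (lt_le_trans st le_tt1))) _ se.
  rewrite lt_eqF// => /(_ isT); rewrite ltr_norml; lra.
have [i Pi gi0] : exists2 i, P i & g i t = 0.
  apply: contrapT => hno.
  have lt0 j : P j -> g j t < 0.
    move=> Pj; rewrite lt_neqAle le0// andbT; apply/eqP => gj0.
    by apply: hno; exists j.
  have hn : \forall s \near within (flow_interval L) t^',
      forall j, P j -> g j s < 0.
    apply: filter_forall => j; have [Pj|/negP nPj] := boolP (P j); last first.
      by near=> s.
    have gj : 0 < - g j t by rewrite oppr_gt0 lt0.
    have /cvgrPdist_lt/(_ _ gj) := derivative_within_cvg (hd _ Dt _ Pj).
    by apply: filterS => s; rewrite ltr_norml => /andP[h _ _]; lra.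
  have [e e0 he] := near_within_ball hn.
  have [s [s01 [k Pk gk]] ste] := inf_adherent e0 hasA.
  have ts : t <= s by apply: ge_inf; [exists 0 | split => //; exists k].
  have Ds : flow_interval L s by case/andP: s01 => *; exact: Dlt.
  have [est|nst] := eqVneq s t.
    by have := lt0 k Pk; rewrite -est ltNge gk.
  have : g k s < 0 by apply: he => //; rewrite ger0_norm ?subr_ge0// ltrBlDl.
  by rewrite ltNge gk.
have tgt0 : 0 < t.
  rewrite lt_neqAle t_ge0 andbT; apply/eqP => t0.
  by have := h0 _ Pi; rewrite {1}t0 gi0 ltxx.
have dneg := hneg _ Dt le0 _ Pi gi0.
have dpos : 0 < - dg i t by rewrite oppr_gt0.
have /cvgrPdist_lt/(_ _ dpos)/near_within_ball[e e0 he] := hd _ Dt _ Pi.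
have [s /andP[s0 st] se] := left e e0 tgt0.
have := he s (Dlt _ s0 (ltW (lt_le_trans st le_tt1))) _ se.
rewrite lt_eqF// => /(_ isT); rewrite gi0 subr0 ltr_norml => /andP[h _].
have : g i s / (s - t) < 0 by lra.
have st0 : s - t < 0 by rewrite subr_lt0.
rewrite ltr_ndivrMr// mul0r => h'.
by have := before _ s0 st _ Pi; rewrite ltNge (ltW h').
Unshelve. all: by end_near.
Qed.

Lemma derivative_within_zero_cst (L : \bar R) g :
  (forall t, flow_interval L t -> derivative_within (flow_interval L) g t 0) ->
  forall t, flow_interval L t -> g t = g 0.
Proof.
move=> hg t Dt.
(* The barrier is a line of small slope e; the sign (-1) ^+ b gives both
   inequalities at once. *)
have key (b : bool) (e : R) : 0 < e ->
    (-1) ^+ b * g t + - (-1) ^+ b * g 0 < e * t + e.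
  move=> e0.
  pose G (b : bool) s := (-1) ^+ b * g s + (- (-1) ^+ b * g 0 - e + - e * s).
  have : G b t < 0.
    apply: (@barrier_principle bool xpredT L G (fun _ _ => - e)) => //.
    - move=> s Ds c _.
      have -> : - e = (-1) ^+ c * 0 + (0 + - e * 1) by ring.
      apply: derivative_withinD; first by apply: derivative_withinZ; exact: hg.
      apply: derivative_withinD; first exact: derivative_within_cst.
      by apply: derivative_withinZ; exact: derivative_within_id.
    - by move=> c _; rewrite /G mulr0; have : 0 < e by []; lra.
    - by move=> *; rewrite oppr_lt0.
  rewrite /G; lra.
have t1 : 0 < t + 1 by case: Dt => *; lra.
apply/eqP; rewrite -subr_eq0; apply/eqP/le_anti/andP; split.
  apply/ler_addgt0Pr => e e0.
  have := key false (e / (t + 1)); rewrite divr_gt0// => /(_ isT).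
  have -> : e / (t + 1) * t + e / (t + 1) = e by field; rewrite gt_eqF.
  rewrite expr0; lra.
rewrite -oppr_le0; apply/ler_addgt0Pr => e e0.
have := key true (e / (t + 1)); rewrite divr_gt0// => /(_ isT).
have -> : e / (t + 1) * t + e / (t + 1) = e by field; rewrite gt_eqF.
rewrite expr1; lra.
Qed.

End DerivativeWithin.

(** * Euclidean triangles *)

Section EuclideanTriangle.
Variable R : realType.
Implicit Types a b c : R.

(** The angle opposite to the side a. *)
Definition triangle_angle a b c : R :=
  acos ((b ^+ 2 + c ^+ 2 - a ^+ 2) / (2 * (b * c))).

Definition strict_triangle a b c : Prop :=
  [/\ 0 < a, 0 < b & 0 < c] /\ [/\ a < b + c, b < c + a & c < a + b].

Lemma strict_triangle_rot a b c :
  strict_triangle a b c -> strict_triangle b c a.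
Proof. by move=> [[? ? ?] [? ? ?]]. Qed.

Lemma triangle_cos_bounds a b c : strict_triangle a b c ->
  -1 < (b ^+ 2 + c ^+ 2 - a ^+ 2) / (2 * (b * c)) < 1.
Proof.
move=> [[a0 b0 c0] [h1 h2 h3]].
have bc0 : 0 < 2 * (b * c) by rewrite !mulr_gt0.
by rewrite ltr_pdivlMr// ltr_pdivrMr// mulN1r mul1r; apply/andP; split; nra.
Qed.

Lemma triangle_angle_gt0 a b c : strict_triangle a b c ->
  0 < triangle_angle a b c < pi.
Proof.
move=> /triangle_cos_bounds/andP[h1 h2].
by rewrite acos_gt0 ?acos_ltpi ?h1 ?h2 ?(ltW h1) ?(ltW h2).
Qed.

Lemma cos_triangle_angle a b c : strict_triangle a b c ->
  cos (triangle_angle a b c) = (b ^+ 2 + c ^+ 2 - a ^+ 2) / (2 * (b * c)).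
Proof.
move=> /triangle_cos_bounds/andP[h1 h2].
by rewrite acosK// in_itv/= !ltW.
Qed.

(** Sixteen times the squared area. *)
Definition heron a b c : R :=
  (a + b + c) * (b + c - a) * (c + a - b) * (a + b - c).

Lemma sin_triangle_angle a b c : strict_triangle a b c ->
  sin (triangle_angle a b c) = Num.sqrt (heron a b c) / (2 * (b * c)).
Proof.
move=> tr; have /andP[h1 h2] := triangle_cos_bounds tr.
have [[a0 b0 c0] [t1 t2 t3]] := tr.
have bc0 : 0 < 2 * (b * c) by rewrite !mulr_gt0.
rewrite sin_acos ?ltW//.
have -> : 1 - ((b ^+ 2 + c ^+ 2 - a ^+ 2) / (2 * (b * c))) ^+ 2 =
    heron a b c / (2 * (b * c)) ^+ 2.
  by rewrite /heron; field; rewrite !gt_eqF.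
rewrite sqrtrM; last by rewrite /heron !mulr_ge0//; lra.
by rewrite sqrtrV ?sqr_ge0// sqrtr_sqr ger0_norm// ltW.
Qed.

(** With the sines given by Heron's formula, the addition formulas yield
    cos (A + B) = - cos C and sin (A + B) > 0.  The latter places A + B in
    [0, pi], where cos is injective. *)
Lemma triangle_angle_sum a b c : strict_triangle a b c ->
  triangle_angle a b c + triangle_angle b c a + triangle_angle c a b = pi.
Proof.
move=> tr; have tr' := strict_triangle_rot tr.
have tr'' := strict_triangle_rot tr'.
have [[a0 b0 c0] [t1 t2 t3]] := tr.
have /andP[A0 Api] := triangle_angle_gt0 tr.
have /andP[B0 Bpi] := triangle_angle_gt0 tr'.
have /andP[C0 Cpi] := triangle_angle_gt0 tr''.
have h0 : 0 < heron a b c by rewrite /heron !mulr_gt0//; lra.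
have hE : heron b c a = heron a b c by rewrite /heron; ring.
set A := triangle_angle a b c in A0 Api *.
set B := triangle_angle b c a in B0 Bpi *.
set C := triangle_angle c a b in C0 Cpi *.
have sq : Num.sqrt (heron a b c) ^+ 2 = heron a b c by rewrite sqr_sqrtr// ltW.
have q0 : 0 < Num.sqrt (heron a b c) by rewrite sqrtr_gt0.
have sE : sin (A + B) = Num.sqrt (heron a b c) / (2 * (a * b)).
  rewrite sinD !sin_triangle_angle// !cos_triangle_angle// hE.
  by field; rewrite !gt_eqF.
have cE : cos (A + B) = - cos C.
  rewrite cosD !sin_triangle_angle// !cos_triangle_angle// hE.
  move: q0 sq; set q := Num.sqrt _ => q0 sq.
  have -> : q / (2 * (b * c)) * (q / (2 * (c * a))) =
     q ^+ 2 / (4 * (a * b * c ^+ 2)) by field; rewrite !gt_eqF.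
  rewrite sq /heron; field.
  by rewrite !gt_eqF.
have AB : A + B < pi.
  rewrite ltNge; apply/negP => h.
  have : 0 < sin (A + B) by rewrite sE divr_gt0// !mulr_gt0.
  have -> : A + B = (A + B - pi) + pi by rewrite subrK.
  rewrite sinDpi oppr_gt0 ltNge sin_ge0_pi//.
  by rewrite subr_ge0 h/= lerBlDr; lra.
suff -> : A + B = pi - C by rewrite subrK.
apply: cos_inj; rewrite ?in_itv/=.
- by rewrite ltW ?ltW// addr_gt0.
- lra.
- by rewrite cE cosB cospi sinpi mulN1r mul0r addr0.
Qed.

(** The law of cosines reads
    a ^+ 2 = (b - c) ^+ 2 + 2 * (1 - cos A) * (b * c), so a side that is short
    compared with the other two faces a small angle. *)
Lemma triangle_angle_small a b c phi : strict_triangle a b c ->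
  0 <= phi <= pi -> a ^+ 2 < 2 * (1 - cos phi) * (b * c) ->
  triangle_angle a b c < phi.
Proof.
move=> tr phi_itv h; have /andP[A0 Api] := triangle_angle_gt0 tr.
have [[a0 b0 c0] _] := tr.
rewrite -ltr_cos ?in_itv/= ?(ltW A0) ?(ltW Api)//.
rewrite cos_triangle_angle// ltr_pdivlMr ?mulr_gt0//.
have := sqr_ge0 (b - c); lra.
Qed.

End EuclideanTriangle.

(** * Combinatorics of triangulated surfaces *)

Section Combinatorics.
Variable V : finType.
Implicit Types (T : {set {set V}}) (f e : {set V}) (i j k v x : V) (s : seq V).

Lemma next_neq_prev s x : uniq s -> (2 < size s)%N -> x \in s ->
  next s x != prev s x.
Proof.
move=> us ss xs; have [n s' rE] := rot_to xs.
rewrite -(next_rot n us) -(prev_rot n us) rE next_nth prev_nth inE eqxx /=.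
have : uniq (x :: s') by rewrite -rE rot_uniq.
have : (2 < size (x :: s'))%N by rewrite -rE size_rot.
case: s' {rE} => [|y [|z s']]// _ /= /and3P[xnot ynot _].
have /= -> := memNindex xnot.
rewrite ?eqxx (nth_last x [:: x, y, z & s']) /=.
by apply: contraNneq ynot => ->; exact: mem_last.
Qed.

Lemma card3_third f i k : #|f| = 3%N -> i \in f -> k \in f -> i != k ->
  exists j, [/\ i != j, j != k & f = [set i; j; k]%SET].
Proof.
move=> f3 fi fk ik.
have : #|f :\: [set i; k]| == 1%N.
  rewrite cardsD (finset.setIidPr _) ?f3 ?cards2 ?ik//.
  by apply/fintype.subsetP => z; rewrite !inE => /orP[]/eqP->.
move=> /cards1P[j jE]; exists j.
have : j \in f :\: [set i; k] by rewrite jE inE.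
rewrite !inE negb_or => /andP[/andP[ji jk] fj].
split=> //; first by rewrite eq_sym.
apply/eqP; rewrite eq_sym eqEcard f3; apply/andP; split.
  by apply/fintype.subsetP => z; rewrite !inE => /orP[/orP[]|]/eqP->.
rewrite finset.setUC cardsU1 cards2 !inE (eq_sym i j) ji/= negb_or.
by rewrite eq_sym ik eq_sym jk.
Qed.

Lemma link_edges_at T s v x :
  link_edges T v = [set [set z; next s z] | z in s]%SET -> uniq s ->
  x \in s ->
  [set e in link_edges T v | x \in e]%SET =
  [set [set x; next s x]; [set x; prev s x]]%SET.
Proof.
move=> lE us xs; apply/finset.setP => e.
rewrite finset.in_set finset.in_set2 lE; apply/andP/idP.
  move=> [/imsetP[z zs ->]]; rewrite !inE => /orP[/eqP<-|/eqP ->].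
    by rewrite eqxx.
  by rewrite prev_next// [X in _ || (X == _)]finset.setUC eqxx orbT.
move=> /orP[]/eqP->; split; rewrite ?inE ?eqxx//.
  by apply/imsetP; exists x.
apply/imsetP; exists (prev s x); first by rewrite mem_prev.
by rewrite next_prev// finset.setUC.
Qed.

(** The faces around v correspond to the sides of its link polygon, and exactly
    two sides of a polygon meet at x; these are distinct since the polygon has
    at least three vertices. *)
Lemma edge_in_two_faces T e : closed_surface_triangulation T ->
  e \in edges T -> #|[set f in T | e \subset f]%SET| = 2%N.
Proof.
move=> [_ T3 hlink _]; rewrite inE => /andP[/cards2P[v [x [vx ->{e}]]]].
move=> /exists_inP[f0 f0T ef0].
have [s [us ss lE]] := hlink v.
have linkP f : f \in T -> v \in f -> (f :\ v)%SET \in link_edges T v.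
  by move=> fT vf; rewrite inE finset.setD11 finset.setD1K.
have xs : x \in s.
  have vf0 : v \in f0 by apply: (fintype.subsetP ef0); rewrite !inE eqxx.
  have := linkP _ f0T vf0; rewrite lE => /imsetP[z zs fz].
  have : x \in (f0 :\ v)%SET.
    rewrite !inE eq_sym vx; apply: (fintype.subsetP ef0).
    by rewrite !inE eqxx orbT.
  by rewrite fz !inE => /orP[]/eqP-> //; rewrite mem_next.
have -> : [set f in T | [set v; x]%SET \subset f]%SET =
    [set (v |: e)%SET | e in [set e in link_edges T v | x \in e]]%SET.
  apply/finset.setP => f; rewrite !inE; apply/andP/imsetP.
    move=> [fT /fintype.subsetP vxf].
    have vf : v \in f by apply: vxf; rewrite !inE eqxx.
    exists (f :\ v)%SET; last by rewrite finset.setD1K.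
    by rewrite inE linkP//= !inE eq_sym vx vxf// !inE eqxx orbT.
  move=> [e]; rewrite !inE => /andP[/andP[ve eT] xe] ->; split=> //.
  apply/fintype.subsetP => z; rewrite !inE => /orP[]/eqP->.
    by rewrite eqxx.
  by rewrite xe orbT.
rewrite card_in_imset; last first.
  move=> e1 e2; rewrite !inE => /andP[/andP[v1 _] _] /andP[/andP[v2 _] _] e12.
  by rewrite -(finset.setU1K v1) e12 finset.setU1K.
rewrite (link_edges_at lE us xs) cards2.
suff -> : [set x; next s x]%SET != [set x; prev s x]%SET by [].
have np := next_neq_prev us ss xs.
apply/eqP => /finset.setP h.
have := h (next s x); have := h (prev s x).
rewrite !inE !eqxx !orbT (eq_sym (prev s x) (next s x)) (negbTE np) !orbF.
move=> /eqP px /esym/eqP nx.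
by rewrite nx px eqxx in np.
Qed.

(** Counts the pairs (edge, face containing it) in two ways. *)
Lemma edges_faces T : closed_surface_triangulation T ->
  (#|edges T| * 2 = #|T| * 3)%N.
Proof.
move=> hT; have [_ T3 _ _] := hT.
rewrite -!sum_nat_const.
transitivity (\sum_(e in edges T) \sum_(f in T | e \subset f) 1)%N.
  apply: eq_bigr => e eT; rewrite -(edge_in_two_faces hT eT) -sum1_card.
  by apply: eq_bigl => f; rewrite inE.
rewrite (exchange_big_dep (mem T))/=; last by move=> e f _ /andP[].
apply: eq_bigr => f fT.
transitivity #|[set e : {set V} | (e \subset f) && (#|e| == 2)%N]%SET|.
  rewrite -sum1_card; apply: eq_bigl => e; rewrite !inE fT/=.
  rewrite andbC; case: (boolP (e \subset f)) => //= ef.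
  apply/andP/idP => [[]//|e2]; split=> //; apply/exists_inP; by exists f.
by rewrite cards_draws T3.
Qed.

(** Some edge of a path from a to b in the 1-skeleton leaves I; any face on that
    edge will do. *)
Lemma mixed_face T (I : {set V}) a b : closed_surface_triangulation T ->
  a \in I -> b \notin I ->
  exists2 f, f \in T & exists2 i, i \in f &
    exists2 k, k \in f & (i \in I) && (k \notin I).
Proof.
move=> [_ _ _ hc] aI bI.
have /connectP[p pth lp] := hc a b.
elim: p a aI pth lp => [|c p IH] a aI /=.
  by move=> _ ba; rewrite ba aI in bI.
move=> /andP[ac pth] lp; have [cI|cI] := boolP (c \in I); first exact: (IH c).
move: ac; rewrite inE => /andP[_ /exists_inP[f fT acf]].
exists f => //; exists a.
  by apply: (fintype.subsetP acf); rewrite !inE eqxx.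
exists c; first by apply: (fintype.subsetP acf); rewrite !inE eqxx orbT.
by rewrite aI.
Qed.

End Combinatorics.

(** * Angles and curvature of PL metrics *)

Section Faces.
Variables (V : finType).
Implicit Types (T : {set {set V}}) (f : {set V}) (i j k : V).

(** Ordered, so that each relabelling of a face is an instance. *)
Definition spans f i j k : Prop :=
  [/\ i != j, j != k, k != i & f = [set i; j; k]%SET].

Lemma spans_rot f i j k : spans f i j k -> spans f j k i.
Proof.
move=> [ij jk ki ->]; split=> //.
by apply/finset.setP => z; rewrite !inE -orbA orbC.
Qed.

Lemma spans_third f i k : #|f| = 3%N -> i \in f -> k \in f -> i != k ->
  exists j, spans f i j k.
Proof.
move=> f3 fi fk ik; have [j [ij jk fE]] := card3_third f3 fi fk ik.
exists j; split=> //; by rewrite eq_sym.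
Qed.

Lemma spans_exists f : #|f| = 3%N -> exists i j k, spans f i j k.
Proof.
move=> f3.
have /card_gt1P[i [k [fi fk ik]]] : (1 < #|f|)%N by rewrite f3.
by have [j fE] := spans_third f3 fi fk ik; exists i, j, k.
Qed.

Lemma spans_mem f i j k : spans f i j k -> i \in f.
Proof. by move=> [_ _ _ ->]; rewrite !inE eqxx. Qed.

Lemma spans_setD1 f i j k : spans f i j k -> (f :\ i)%SET = [set j; k]%SET.
Proof.
move=> [ij jk ki ->]; apply/finset.setP => z; rewrite !inE.
have [->|//] := eqVneq z i.
by rewrite (negbTE ij) eq_sym (negbTE ki).
Qed.

Lemma big_pair (A : Type) (idx : A) (op : Monoid.com_law idx) (F : V -> A) i j :
  i != j ->
  \big[op/idx]_(x in [set i; j]%SET) F x = op (F i) (F j).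
Proof. by move=> ij; rewrite big_setU1 ?inE//= big_set1. Qed.

Lemma big_spans (A : Type) (idx : A) (op : Monoid.com_law idx) (F : V -> A)
    f i j k : spans f i j k ->
  \big[op/idx]_(x in f) F x = op (F i) (op (F j) (F k)).
Proof.
move=> fE; rewrite (bigD1 i) ?(spans_mem fE)//=; congr (op _ _).
have [_ jk _ _] := fE; rewrite -(big_pair op F jk) -(spans_setD1 fE).
by apply: eq_bigl => x; rewrite !inE andbC.
Qed.
End Faces.

Section PLGeometry.
Variables (R : realType) (V : finType) (T : {set {set V}}).
Hypothesis T3 : forall f, f \in T -> #|f| = 3%N.
Implicit Types (d : {set V} -> R) (u : V -> R) (f : {set V}) (i j k : V).

Lemma spans_edge f i j k : f \in T -> spans f i j k -> (f :\ i)%SET \in edges T.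
Proof.
move=> fT fE; rewrite inE; apply/andP; split.
  by have [_ jk _ _] := fE; rewrite (spans_setD1 fE) cards2 jk.
by apply/exists_inP; exists f => //; exact: subD1set.
Qed.

Lemma pl_strict_triangle d f i j k : pl_metric T d -> f \in T ->
  spans f i j k ->
  strict_triangle (d (f :\ i)%SET) (d (f :\ j)%SET) (d (f :\ k)%SET).
Proof.
move=> [d0 dT] fT fE.
have fE' := spans_rot fE; have fE'' := spans_rot fE'.
split; first by split; apply: d0;
  [apply: spans_edge fE | apply: spans_edge fE' | apply: spans_edge fE''].
have key a b c : spans f a b c ->
    d (f :\ a)%SET < d (f :\ b)%SET + d (f :\ c)%SET.
  move=> fabc.
  rewrite (spans_setD1 fabc) (spans_setD1 (spans_rot fabc)).
  rewrite (spans_setD1 (spans_rot (spans_rot fabc))) addrC.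
  rewrite (finset.setUC [set a]%SET [set b]%SET).
  rewrite (finset.setUC [set c]%SET).
  have [_ _ _ fE3] := spans_rot fabc; apply: dT.
  by rewrite -fE3.
by split; apply: key.
Qed.

Lemma inner_angleE d f i j k : spans f i j k ->
  inner_angle d f i =
  triangle_angle (d (f :\ i)%SET) (d (f :\ j)%SET) (d (f :\ k)%SET).
Proof.
move=> fE; have [_ jk _ _] := fE.
rewrite /inner_angle {1 3}(spans_setD1 fE) !big_pair//.
Qed.

Lemma conformal_changeE d u f i j k : spans f i j k ->
  conformal_change u d (f :\ i)%SET = u j * u k * d (f :\ i)%SET.
Proof.
move=> fE; have [_ jk _ _] := fE.
by rewrite /conformal_change {1}(spans_setD1 fE) big_pair.
Qed.

Lemma inner_angle_gt0 d f i : pl_metric T d -> f \in T -> i \in f ->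
  0 < inner_angle d f i < pi.
Proof.
move=> hd fT fi.
have [k ki kf] : exists2 k, k != i & k \in f.
  have /card_gt1P[a [b [fa fb ab]]] : (1 < #|f|)%N by rewrite T3.
  by have [ai|ai] := eqVneq a i; [exists b; rewrite // -ai eq_sym | exists a].
rewrite eq_sym in ki.
have [j fE] := spans_third (T3 fT) fi kf ki.
rewrite (inner_angleE d fE) triangle_angle_gt0//.
exact: pl_strict_triangle fE.
Qed.

Lemma face_angle_sum d f : pl_metric T d -> f \in T ->
  \sum_(i in f) inner_angle d f i = pi.
Proof.
move=> hd fT; have [i [j [k fE]]] := spans_exists (T3 fT).
rewrite (big_spans _ _ fE)/=.
rewrite (inner_angleE d fE) (inner_angleE d (spans_rot fE)).
rewrite (inner_angleE d (spans_rot (spans_rot fE))) addrA triangle_angle_sum//.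
exact: pl_strict_triangle fE.
Qed.

Lemma sum_curvature d (I : {set V}) : \sum_(i in I) curvature T d i =
  2 * pi * #|I|%:R - \sum_(f in T) \sum_(i in f | i \in I) inner_angle d f i.
Proof.
rewrite /curvature sumrB sumr_const -(mulr_natr (2 * pi)); congr (_ - _).
rewrite (exchange_big_dep (mem T))/=; last by move=> i f _ /andP[].
apply: eq_bigr => f fT; apply: eq_bigl => i; by rewrite fT/= andbC.
Qed.

Lemma total_curvature d : pl_metric T d ->
  \sum_i curvature T d i = 2 * pi * #|V|%:R - pi * #|T|%:R.
Proof.
move=> hd; have := sum_curvature d [set: V]%SET.
under eq_bigl do rewrite inE.
rewrite cardsT => ->; congr (_ - _).
rewrite mulr_natr -sumr_const; apply: eq_bigr => f fT.
rewrite -(face_angle_sum hd fT); apply: eq_bigl => i.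
by rewrite inE andbT.
Qed.
End PLGeometry.

Section GaussBonnet.
Variables (R : realType) (V : finType) (T : {set {set V}}).
Hypothesis hT : closed_surface_triangulation T.

(** The angles of each face add up to pi, so the total curvature is
    2 pi V - pi F, and 2 E = 3 F turns this into 2 pi (V - E + F). *)
Lemma gauss_bonnet (d : {set V} -> R) : pl_metric T d ->
  \sum_i curvature T d i = #|V|%:R * average_curvature R T.
Proof.
have [V0 T3 _ _] := hT.
move=> hd; rewrite (total_curvature T3 hd) /average_curvature mulrC.
rewrite [RHS]mulrC divfK ?pnatr_eq0 -?lt0n//.
have := edges_faces hT => /(congr1 (fun n => n%:R : R)); rewrite !natrM => h.
rewrite /euler_characteristic rmorphD rmorphB/= -!pmulrn.
have -> : #|edges T|%:R = #|T|%:R * 3 / 2 :> R by rewrite -h mulfK.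
by field.
Qed.
End GaussBonnet.

(** * Comparing curvatures across a large gap in the conformal factor *)

Section Comparison.
Variables (R : realType) (V : finType) (T : {set {set V}}).
Hypothesis hT : closed_surface_triangulation T.
Variables (d d' : {set V} -> R).
Hypotheses (hd : pl_metric T d) (hd' : pl_metric T d').
Implicit Types (u : V -> R) (I f : {set V}) (i j k : V).

Let T3 : forall f, f \in T -> #|f| = 3%N. Proof. by case: hT. Qed.

(** These inequalities concern a face on which u is, at some vertices, at most q
    times its value at each of the other vertices.  By the first, there cannot
    be just one such small vertex; by the second, if there are two, then the
    angle at the third vertex is smaller for u * d than for d'. *)
Definition separating_ratio (q : R) : Prop :=
  [/\ 0 < q, q < 1 & forall f i j k, f \in T -> spans f i j k ->
    q * (d (f :\ j)%SET + d (f :\ k)%SET) < d (f :\ i)%SET /\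
    q ^+ 2 * d (f :\ k)%SET ^+ 2 <
      2 * (1 - cos (inner_angle d' f k)) * (d (f :\ i)%SET * d (f :\ j)%SET)].

Lemma separating_ratio_exists : exists q, separating_ratio q.
Proof.
(* Both inequalities hold in the limit q = 0, and there are finitely many of
   them. *)
suff hn : \forall q \near (0 : R)^'+, separating_ratio q.
  exact: (@filter_ex _ _ (at_right_proper_filter (0 : R)) _ hn).
have q0 : \forall q \near (0 : R)^'+, 0 < q by exact: nbhs_right_gt.
have q1 : \forall q \near (0 : R)^'+, q < 1 by apply: nbhs_right_lt.
suff h : \forall q \near (0 : R)^'+, forall f i j k, f \in T -> spans f i j k ->
    q * (d (f :\ j)%SET + d (f :\ k)%SET) < d (f :\ i)%SET /\
    q ^+ 2 * d (f :\ k)%SET ^+ 2 <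
      2 * (1 - cos (inner_angle d' f k)) * (d (f :\ i)%SET * d (f :\ j)%SET).
  by near=> q; split; near: q.
apply: filter_forall => f; apply: filter_forall => i; apply: filter_forall => j.
apply: filter_forall => k.
have [[fT fE]|nf] := pselect (f \in T /\ spans f i j k); last first.
  by near=> q => fT fE; case: nf.
have [[d1 d2 d3] _] := pl_strict_triangle hd fT fE.
have kf := spans_mem (spans_rot (spans_rot fE)).
have /andP[t0 tpi] := inner_angle_gt0 T3 hd' fT kf.
have c0 : 0 < 1 - cos (inner_angle d' f k).
  rewrite subr_gt0 -cos0 ltr_cos// in_itv/=.
    by rewrite lexx pi_ge0.
  by rewrite (ltW t0) (ltW tpi).
set c := 2 * (1 - cos _) * _.
have cpos : 0 < c by rewrite /c !mulr_gt0.
have h1 : \forall q \near (0 : R)^'+,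
    q < d (f :\ i)%SET / (d (f :\ j)%SET + d (f :\ k)%SET).
  by apply: nbhs_right_lt; rewrite divr_gt0// addr_gt0.
have h2 : \forall q \near (0 : R)^'+, q < c / d (f :\ k)%SET ^+ 2.
  by apply: nbhs_right_lt; rewrite divr_gt0// exprn_gt0.
near=> q => _ _; split.
  by rewrite -ltr_pdivlMr ?addr_gt0//; near: q.
rewrite -ltr_pdivlMr ?exprn_gt0//; apply: (@lt_trans _ _ q); last by near: q.
have Q0 : 0 < q by near: q.
by rewrite expr2 gtr_pMl//; near: q.
Unshelve. all: by end_near.
Qed.

Definition separated q u I : Prop :=
  forall i k, i \in I -> k \notin I -> u i <= q * u k.

(** The face has one or two vertices in I.  Were there only i, the side opposite
    to i would be longer than the two others together.  If there are two, the
    third angle shrinks below its d'-value, so, the angle sum being pi, the sum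
    over the other two exceeds its d'-value. *)
Lemma mixed_face_angles q u I f i k : separating_ratio q ->
  conformal_factor T d u -> separated q u I -> f \in T ->
  i \in f -> i \in I -> k \in f -> k \notin I ->
  \sum_(x in f | x \in I) inner_angle d' f x <
  \sum_(x in f | x \in I) inner_angle (conformal_change u d) f x.
Proof.
move=> [q0 q1 hq] [u0 hu] sep fT fi iI fk kI.
have ik : i != k by apply: contraNneq kI => <-.
have [j fE] := spans_third (T3 fT) fi fk ik.
have fE' := spans_rot fE; have fE'' := spans_rot fE'.
have tr := pl_strict_triangle hu fT fE.
have [[d1 d2 d3] _] := pl_strict_triangle hd fT fE.
have [hq1 hq2] := hq f i j k fT fE.
have uik := sep i k iI kI.
have [ui uj uk] := And3 (u0 i) (u0 j) (u0 k).
have ukq : 0 < u k * q by rewrite mulr_gt0.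
have [jI|jI] := boolP (j \in I); last first.
  (* i alone in I: the triangle inequality fails *)
  have uij := sep i j iI jI.
  move: tr => [_ [+ _ _]].
  rewrite (conformal_changeE d u fE) (conformal_changeE d u fE').
  rewrite (conformal_changeE d u fE'') ltNge => /negP[].
  apply: (@le_trans _ _ (u j * u k * (q * (d (f :\ j)%SET + d (f :\ k)%SET)))).
    have -> : u j * u k * (q * (d (f :\ j)%SET + d (f :\ k)%SET)) =
      u k * (q * u j) * d (f :\ j)%SET + (q * u k) * u j * d (f :\ k)%SET.
      by ring.
    by rewrite lerD// !ler_pM2r// ler_pM2l.
  by rewrite ler_pM2l ?mulr_gt0// ltW.
have ujk := sep j k jI kI.
have /andP[t0 tpi] := inner_angle_gt0 T3 hd' fT fk.
have lt_k : inner_angle (conformal_change u d) f k < inner_angle d' f k.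
  rewrite (inner_angleE (conformal_change u d) fE'').
  apply: triangle_angle_small.
  - exact: (pl_strict_triangle hu fT fE'').
  - by rewrite (ltW t0) (ltW tpi).
  rewrite (conformal_changeE d u fE) (conformal_changeE d u fE').
  rewrite (conformal_changeE d u fE'').
  set c := 2 * _ in hq2 *.
  have -> : c * (u j * u k * d (f :\ i)%SET * (u k * u i * d (f :\ j)%SET)) =
     u i * u j * (u k ^+ 2 * (c * (d (f :\ i)%SET * d (f :\ j)%SET))) by ring.
  have -> : (u i * u j * d (f :\ k)%SET) ^+ 2 =
     u i * u j * (u i * u j * d (f :\ k)%SET ^+ 2) by ring.
  rewrite ltr_pM2l ?mulr_gt0//.
  apply: (@le_lt_trans _ _ (u k ^+ 2 * (q ^+ 2 * d (f :\ k)%SET ^+ 2))).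
    rewrite mulrA ler_pM2r ?exprn_gt0//.
    have -> : u k ^+ 2 * q ^+ 2 = q * u k * (q * u k) by ring.
    by apply: ler_pM => //; exact: ltW.
  by rewrite ltr_pM2l ?exprn_gt0.
have := face_angle_sum T3 hd' fT; have := face_angle_sum T3 hu fT.
rewrite !(big_spans _ _ fE)/= => s1 s2.
rewrite !big_mkcondr/= !(big_spans _ _ fE)/= iI jI (negbTE kI).
lra.
Qed.

Hypothesis const_curv : forall i j, curvature T d' i = curvature T d' j.

Lemma constant_curvatureE i : curvature T d' i = average_curvature R T.
Proof.
have [V0 _ _ _] := hT.
have := gauss_bonnet hT hd'.
rewrite (eq_bigr (fun=> curvature T d' i)) => [|j _]; last exact: const_curv.
rewrite sumr_const -(mulr_natl (curvature T d' i)) => /mulfI; apply.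
by rewrite pnatr_eq0 -lt0n.
Qed.

(** The d'-curvatures over I sum to #|I| times the average, so the difference of
    the two curvature sums is a sum over faces of differences of angle sums over
    the vertices in I.  Faces inside I or disjoint from I contribute nothing,
    and mixed faces, of which there is at least one, contribute negatively. *)
Lemma separated_curvature_lt q u I : separating_ratio q ->
  conformal_factor T d u -> separated q u I ->
  I != finset.set0 -> I != [set: V]%SET ->
  \sum_(i in I)
    (curvature T (conformal_change u d) i - average_curvature R T) < 0.
Proof.
move=> hq hu sep /set0Pn[a aI].
rewrite -finset.subTset => /subsetPn[b _ bI].
have -> : \sum_(i in I)
  (curvature T (conformal_change u d) i - average_curvature R T)
  = \sum_(i in I) curvature T (conformal_change u d) i -
    \sum_(i in I) curvature T d' i.
  by rewrite -sumrB; apply: eq_bigr => i _; rewrite constant_curvatureE.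
have cancel_left (x y z : R) : (x - y) - (x - z) = z - y by ring.
rewrite !sum_curvature cancel_left subr_lt0.
have [f fT [i fi [k fk /andP[iI kI]]]] := mixed_face hT aI bI.
rewrite (bigD1 f)//= [ltRHS](bigD1 f)//=.
apply: ltr_leD; first exact: (@mixed_face_angles q u I f i k).
apply: ler_sum => g /andP[gT _].
have [gI|/subsetPn[k' gk' kI']] := boolP (g \subset I).
  have e : (fun x => (x \in g) && (x \in I)) =1 (mem g).
    by move=> x /=; apply: andb_idr => /(fintype.subsetP gI).
  rewrite (eq_bigl _ _ e) [leRHS](eq_bigl _ _ e).
  case: hu => _ hu'.
  by rewrite (face_angle_sum T3 hd' gT) (face_angle_sum T3 hu' gT).
have [/pred0P g0|/pred0Pn[i' /= /andP[gi' iI']]] :=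
    boolP (pred0b (fun x => (x \in g) && (x \in I))).
  by rewrite !big_pred0.
by apply/ltW/(@mixed_face_angles q u I g i' k').
Qed.

End Comparison.

(** * Bounds along the flow *)

Section Flow.
Variables (R : realType) (V : finType) (T : {set {set V}}).
Hypothesis hT : closed_surface_triangulation T.
Variables (d : {set V} -> R) (L : \bar R) (u : R -> V -> R).
Hypothesis hu : normalized_yamabe_flow T d L u.

Let T3 : forall f, f \in T -> #|f| = 3%N. Proof. by case: hT. Qed.

(** In this variable the flow becomes y_i' = K_i - K_av, and u_i tends to 0
    exactly when y_i tends to infinity. *)
Definition neg_log (i : V) (t : R) : R := - ln (u t i).

Lemma neg_log0 i : neg_log i 0 = 0.
Proof. by case: hu => _ u1 _ _; rewrite /neg_log u1 ln1 oppr0. Qed.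

Lemma neg_log_derivative t i : flow_interval L t ->
  derivative_within (flow_interval L) (neg_log i) t
    (curvature T (conformal_change (u t) d) i - average_curvature R T).
Proof.
case: hu => _ _ hc hf Dt; have [u0 _] := hc t Dt.
have h := derivative_within_ln (u0 i) (hf t Dt i).
have -> : neg_log i = fun s => -1 * ln (u s i).
  by apply/funext => s; rewrite mulN1r.
have := derivative_withinZ (c := -1) h.
suff -> : forall K, -1 * (- u t i * K / u t i) = K by [].
by move=> K; field; rewrite gt_eqF.
Qed.

Lemma neg_log_bounded_no_singularity (B : R) :
  (forall t i, flow_interval L t -> neg_log i t < B) ->
  ~ essential_singularity L u.
Proof.
case: hu => _ _ hc _ hB [i [t [Dt _ ut]]].
have e0 : 0 < expR (- B) by exact: expR_gt0.
move: ut => /cvgrPdist_lt/(_ _ e0)[n _ /(_ n (leqnn n))] /=.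
have [u0 _] := hc _ (Dt n).
rewrite sub0r normrN ger0_norm ?ltW//.
have := hB _ i (Dt n); rewrite /neg_log ltrNl => h1 h2.
have : expR (- B) < u (t n) i by rewrite -[ltRHS]lnK ?posrE// ltr_expR.
by rewrite ltNge ltW.
Qed.

Lemma curvature_le i t : flow_interval L t ->
  curvature T (conformal_change (u t) d) i <= 2 * pi.
Proof.
case: hu => _ _ hc _ Dt; have [_ hpl] := hc t Dt.
rewrite /curvature lerBlDr lerDl sumr_ge0// => f /andP[fT fi].
by have /andP[/ltW] := inner_angle_gt0 T3 hpl fT fi.
Qed.

Lemma neg_log_linear_bound t i : flow_interval L t ->
  neg_log i t < (`|2 * pi - average_curvature R T| + 1) * t + 1.
Proof.
move=> Dt; set C := `|_| + 1.
pose g (j : V) s := neg_log j s + (- 1 + - C * s).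
suff : g i t < 0 by rewrite /g; lra.
pose dg j s := curvature T (conformal_change (u s) d) j
  - average_curvature R T + (0 + - C * 1).
apply: (@barrier_principle R V xpredT L g dg) => //.
- move=> s Ds j _; apply: derivative_withinD; first exact: neg_log_derivative.
  apply: derivative_withinD; first exact: derivative_within_cst.
  by apply: derivative_withinZ; exact: derivative_within_id.
- by move=> j _; rewrite /g neg_log0; lra.
- move=> s Ds _ j _ _; rewrite /dg.
  have := curvature_le j Ds; have := ler_norm (2 * pi - average_curvature R T).
  rewrite /C; lra.
Qed.

(** Gauss-Bonnet makes the product of the u_i a constant of motion. *)
Lemma sum_neg_log t : flow_interval L t -> \sum_i neg_log i t = 0.
Proof.
move=> Dt.
have hg s : flow_interval L s ->
    derivative_within (flow_interval L) (fun s => \sum_i neg_log i s) s 0.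
  move=> Ds; case: hu => _ _ hc _; have [_ hpl] := hc s Ds.
  have sum0 : \sum_i (curvature T (conformal_change (u s) d) i -
      average_curvature R T) = 0.
    rewrite sumrB (gauss_bonnet hT hpl) sumr_const.
    by rewrite -(mulr_natl (average_curvature R T)) subrr.
  rewrite -[X in derivative_within _ _ _ X]sum0.
  by apply: derivative_within_sum => i; exact: neg_log_derivative.
rewrite (derivative_within_zero_cst hg Dt).
by rewrite big1// => i _; exact: neg_log0.
Qed.

Variable d' : {set V} -> R.
Hypotheses (hd : pl_metric T d) (hd' : pl_metric T d').
Hypothesis const_curv : forall i j, curvature T d' i = curvature T d' j.

(** For M > 0, a concave function of k that vanishes at 0 and at #|V|; its
    second difference is - M. *)
Definition barrier_height (M : R) (k : nat) : R :=
  M / 2 * (k%:R * (#|V|%:R - k%:R)).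

(** Comparing I with I minus i and with I plus k bounds y_i from below and y_k
    from above by consecutive increments of the barrier height; the increments
    drop by - ln q, hence y_i - y_k >= - ln q. *)
Lemma touching_separated q t (I : {set V}) : 0 < q -> flow_interval L t ->
  (forall J : {set V},
     \sum_(i in J) neg_log i t <= barrier_height (- ln q) #|J|) ->
  \sum_(i in I) neg_log i t = barrier_height (- ln q) #|I| ->
  separated q (u t) I.
Proof.
move=> q0 Dt hle heq i k iI kI.
have [u0 _] : conformal_factor T d (u t) by case: hu => _ _ hc _; exact: hc.
have h1 := hle (I :\ i)%SET; have h2 := hle (k |: I)%SET.
move: h1 h2 heq; rewrite big_setU1//= !(big_setD1 i iI)/=.
rewrite cardsU1 kI add1n (cardsD1 i I) iI add1n /barrier_height /neg_log.
set m := #|(I :\ i)%SET|; set S := \sum_(_ in _) _.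
rewrite -(natr1 m.+1) -(natr1 m) => h1 h2 h3.
have : ln (u t i) <= ln q + ln (u t k) by lra.
by rewrite -lnM ?posrE// ler_ln ?posrE// mulr_gt0.
Qed.

(** The sums of the y_i over all nonempty proper sets J obey the barrier
    principle with the barrier heights of #|J| as bounds: if J reaches its bound
    while no other set exceeds its own, then J is separated from its complement
    and its sum is decreasing. *)
Lemma neg_log_bound q t i : separating_ratio T d d' q -> flow_interval L t ->
  neg_log i t < barrier_height (- ln q) 1 + 1.
Proof.
move=> hq Dt; have [q0 q1 _] := hq.
set M := - ln q.
have M0 : 0 < M by rewrite oppr_gt0 ln_lt0// q0.
have N1 : 1 <= #|V|%:R :> R by rewrite ler1n; case: hT.
have a1 : 0 <= barrier_height M 1.
  by rewrite /barrier_height mul1r mulr_ge0 ?subr_ge0// divr_ge0// ltW.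
pose P (I : {set V}) := (I != finset.set0) && (I != [set: V]%SET).
pose g (I : {set V}) s := \sum_(i in I) neg_log i s + - barrier_height M #|I|.
pose dg (I : {set V}) s := \sum_(i in I)
  (curvature T (conformal_change (u s) d) i - average_curvature R T) + 0.
have hg : forall s, flow_interval L s -> forall I, P I -> g I s < 0.
  apply: (@barrier_principle R {set V} P L g dg).
  - move=> s Ds I _.
    apply: derivative_withinD; last exact: derivative_within_cst.
    by apply: derivative_within_sum => j; exact: neg_log_derivative.
  - move=> I /andP[I0 IT]; rewrite /g big1 => [|j _]; last exact: neg_log0.
    rewrite add0r oppr_lt0 /barrier_height !mulr_gt0 ?invr_gt0//.
      by rewrite ltr0n card_gt0.
    by rewrite subr_gt0 ltr_nat -cardsT proper_card// finset.properT.
  - move=> s Ds hle I PI gI; have /andP[I0 IT] := PI.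
    rewrite /dg addr0.
    apply: (separated_curvature_lt hT hd hd' const_curv hq) => //.
      by case: hu => _ _ hc _; exact: hc.
    apply: touching_separated => //; last exact: subr0_eq.
    move=> J; have [PJ|] := boolP (P J); first by rewrite -subr_le0; exact: hle.
    rewrite negb_and !negbK => /orP[]/eqP->.
      by rewrite big_set0 cards0 /barrier_height mul0r mulr0.
    under eq_bigl do rewrite inE.
    by rewrite sum_neg_log// cardsT /barrier_height subrr !mulr0.
have [iT|iT] := eqVneq [set i]%SET [set: V]%SET.
  have -> : neg_log i t = \sum_(j in [set: V]%SET) neg_log j t.
    by rewrite -iT big_set1.
  by under eq_bigl do rewrite inE; rewrite sum_neg_log//; lra.
have : g [set i]%SET t < 0.
  apply: hg => //; rewrite /P iT andbT; apply/set0Pn.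
  by exists i; rewrite inE.
rewrite /g big_set1 cards1; lra.
Qed.

End Flow.

Theorem theorem1p3 (R : realType) (V : finType) (T : {set {set V}})
    (hT : closed_surface_triangulation T)
    (d : {set V} -> R) (hd : pl_metric T d) :
  (forall (L : R) (u : R -> V -> R),
     normalized_yamabe_flow T d L%:E u -> ~ essential_singularity L%:E u) /\
  (admissible R T ->
   forall u : R -> V -> R,
     normalized_yamabe_flow T d +oo%E u -> ~ essential_singularity +oo%E u).
Proof.
split=> [L u hu|[d' hd' hcst] u hu].
  pose C : R := `|2 * pi - average_curvature R T| + 1.
  apply: (@neg_log_bounded_no_singularity _ _ _ _ _ _ hu (C * L + 1)) => t i Dt.
  apply: (lt_le_trans (neg_log_linear_bound hT hu i Dt)).
  rewrite lerD2r ler_pM2l; last by rewrite ltr_wpDl.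
  by case: Dt => _; rewrite lte_fin => /ltW.
have [q hq] := separating_ratio_exists hT hd hd'.
apply: (neg_log_bounded_no_singularity hu) => t i Dt.
exact: (neg_log_bound hT hu hd hd' hcst i hq Dt).
Qed.
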